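(* There is no Montel space which is isomorphically universal for all separable Montel spaces; that is, there is no Montel space $X$ such that every separable Montel space is linearly isomorphic (as a topological vector space) to a closed subspace of $X$.
   Context: A Fréchet space is a completely metrizable locally convex topological vector space (real scalars) whose topology can be defined by an invariant metric. A subset $K$ of a Fréchet space is bounded if for every neighborhood $U$ of $0$ there is $a\in\mathbb{R}$ with $K\subseteq aU$. Here a Montel space means a Fréchet space all of whose closed bounded subsets are compact (Heine--Borel property). *)

(* Defs.v *)
From HB Require Import structures.
From mathcomp Require Import all_boot all_order all_algebra.
From mathcomp Require Import all_classical all_reals all_analysis.
Import Order.TTheory GRing.Theory Num.Theory.
Import numFieldNormedType.Exports.

Set Implicit Arguments.
Unset Strict Implicit.
Unset Printing Implicit Defensive.

Local Open Scope classical_set_scope.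
Local Open Scope ring_scope.

(* A [tvsType R] is a locally convex topological vector space bundled with some
   uniformity inducing its topology. That uniformity need not be the
   translation-invariant one, so every notion below depends only on the
   topology and on the linear structure. *)

Section FrechetMontel.
Context {R : realType}.

Definition is_metric (T : Type) (d : T -> T -> R) : Prop :=
  [/\ forall x y, 0 <= d x y,
      forall x y, d x y = 0 <-> x = y,
      forall x y, d x y = d y x &
      forall x y z, d x z <= d x y + d y z].

Definition induces_topology (T : topologicalType) (d : T -> T -> R) : Prop :=
  forall (x : T) (U : set T),
    nbhs x U <-> exists2 e : R, 0 < e & [set y | d x y < e] `<=` U.

(* The limit is taken in the topology of [T]; this is used only for metrics
   inducing that topology. *)
Definition complete_metric (T : topologicalType) (d : T -> T -> R) : Prop :=
  forall u : nat -> T,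
    (forall e : R, 0 < e -> exists N : nat, forall m n : nat,
       (N <= m)%N -> (N <= n)%N -> d (u m) (u n) < e) ->
    exists l : T, u @ \oo --> l.

Definition invariant_metric (E : zmodType) (d : E -> E -> R) : Prop :=
  forall x y z : E, d (x + z) (y + z) = d x y.

Definition completely_metrizable (T : topologicalType) : Prop :=
  exists d : T -> T -> R,
    [/\ is_metric d, induces_topology d & complete_metric d].

Definition invariantly_metrizable (E : tvsType R) : Prop :=
  exists d : E -> E -> R,
    [/\ is_metric d, induces_topology d & invariant_metric d].

Definition frechet (E : tvsType R) : Prop :=
  completely_metrizable E /\ invariantly_metrizable E.

Definition tvs_bounded (E : tvsType R) (K : set E) : Prop :=
  forall U : set E, nbhs (0 : E) U ->
    exists a : R, K `<=` [set a *: x | x in U].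

Definition montel (E : tvsType R) : Prop :=
  frechet E /\
  forall K : set E, closed K -> tvs_bounded K -> compact K.

Definition separable_space (T : topologicalType) : Prop :=
  exists2 S : set T, countable S & dense S.

Definition closed_linear_subspace (X : tvsType R) (F : set X) : Prop :=
  closed F /\ submod_closed (mem F).

(* [g] matters only on [F], where it is the inverse of [f]; its continuity is
   for the topology that [F] inherits from [X]. *)
Definition tvs_isomorphic_onto (Y X : tvsType R) (F : set X) : Prop :=
  exists (f : {linear Y -> X}) (g : X -> Y),
    [/\ range f = F, cancel f g, continuous f & {within F, continuous g}].

End FrechetMontel.

(* Main.v *)
Require Import Defs.
From HB Require Import structures.
From mathcomp Require Import all_boot all_order all_algebra.
From mathcomp Require Import all_classical all_reals all_analysis.
From mathcomp Require Import ring lra.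
Import Order.TTheory GRing.Theory Num.Theory.
Import numFieldNormedType.Exports.

(** The proof is a diagonal argument, made possible by the fact that compactness
of bounded sets in a Montel space [X] says that a certain tree attached to [X]
has no infinite branch.

Fix a decreasing base [W 0, W 1, ...] of balanced neighbourhoods of [0] in [X].
A sequence of [X] cannot be both bounded and [W N]-separated, because its
closure would be compact ([montel_no_separated_bounded]).  A first consequence is
that [X] has a countable dense family [D] ([montel_countable_net]): otherwise,
shrinking the space countably many times to multiples of [W 0], [W 1], ... while
keeping it impossible to cover by countably many translates of [W N] would leave
room for such a sequence.  A second one is that the tree of the finite attempts
to build such a sequence inside [D], each attempt recording also the bounds that
it promises to respect, has no infinite branch ([test_tree_no_branch]).

With a tree [T] without infinite branch comes a Montel space.  Index
sequences by the nodes of [T] and use the weights [weight c j], the products of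
the first [j] functions among [c 0, c 1, ...], where [c j t] is a code of an
initial segment of the node [t].  The Koethe space of these weights is Montel as
soon as no infinite set of nodes makes almost all [c j] bounded
([kspace_montel]), and for [T] this is Koenig's lemma ([tree_code_montel]).  Being
Montel, this space is separable by the first consequence above.

Take for [T] the tree of [X] itself, and suppose that the resulting space
embeds in [X] by [f].  Let [e t] be the unit vector at the node [t].
Starting from the empty attempt, extend an attempt [t] by a point of [D] close to
[f (e t)].  Distinct unit vectors are at distance at least [1], so these points are
uniformly separated; and the weights are such that, for each [j], the size of
[f (e t)] with respect to [W j] is controlled by an initial segment of [t],
hence by a bound which can be announced in time.  So the attempts all belong to
[T], and they form an infinite branch ([no_embedding]).

The only unknown when [T] is defined is how much of [t] is needed to control
[f (e t)] with respect to [W j], and which [W N] separates; this depends on [f].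
For this reason the entries of an attempt carry a level, which can be chosen
large at will, and the level decides how much of the node the weights see
([cut]). *)

Set Implicit Arguments.
Unset Strict Implicit.
Unset Printing Implicit Defensive.

Local Open Scope classical_set_scope.
Local Open Scope ring_scope.

(** * Generalities *)

Lemma exists_invn (R : realType) (e : R) : 0 < e -> exists n : nat, n.+1%:R^-1 < e.
Proof.
move=> e0; exists (Num.truncn e^-1).
by rewrite -[ltRHS]invrK ltf_pV2 ?posrE ?invr_gt0// truncnS_gt.
Qed.

(** Recursion in which each term may depend on all the previous ones. *)
Lemma history_choice (T : Type) (P : seq T -> T -> Prop) :
  (forall s, exists x, P s x) ->
  exists u : nat -> T, forall n, P (mkseq u n) (u n).
Proof.
move=> /choice[next nextP].
pose t n := iter n (fun s => rcons s (next s)) [::].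
exists (fun n => next (t n)) => n.
suff -> : mkseq (fun k => next (t k)) n = t n by [].
by elim: n => [//|n IH]; rewrite mkseqS IH.
Qed.

Lemma infinite_fiber (X : Type) (S : set X) (h : X -> nat) (B : nat) :
  infinite_set S -> (forall x, S x -> (h x <= B)%N) ->
  exists b, infinite_set (S `&` [set x | h x = b]).
Proof.
move=> Sinf hB; apply: contrapT => /forallNP fib; apply: Sinf.
apply: (@sub_finite_set _ _ (\bigcup_(b in `I_B.+1) (S `&` [set x | h x = b]))).
  by move=> x Sx; exists (h x) => //=; rewrite ltnS hB.
by apply: bigcup_finite => [|b _]; [exact: finite_II|exact: contrapT (fib b)].
Qed.

Lemma finite_pickle_le (X : countType) (B : nat) :
  finite_set [set x : X | (pickle x <= B)%N].
Proof.
apply: (@finite_preimage _ _ `I_B.+1 (@pickle X)) => [x y _ _|].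
  exact: (pcan_inj pickleK).
exact: finite_II.
Qed.

Lemma filter_finite_forall (T : Type) (I : choiceType) (F : set_system T) (FF : Filter F)
    (S : set I) (P : I -> set T) :
  finite_set S -> (forall t, S t -> F (P t)) ->
  F [set z | forall t, S t -> P t z].
Proof.
move=> /finite_seqP[s ->]; elim: s => [|t s IH] FP.
  by apply: filterS filterT.
have FPs : F [set z | forall t, t \in s -> P t z].
  by apply: IH => r rs; apply: FP; rewrite /= inE rs orbT.
have FPt : F (P t) by apply: FP; rewrite /= inE eqxx.
apply: filterS (filterI FPt FPs) => z [Pt Ps] r /=.
by rewrite inE => /orP[/eqP->|/Ps].
Qed.

(** * F-normed spaces *)

(** An F-norm with convex balls: a single translation-invariant metric then
gives a locally convex topology. *)
Record fnorm (R : realType) (E : lmodType R) := FNorm {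
  fnval :> E -> R;
  fnorm_eq0 : forall x, fnval x = 0 -> x = 0;
  fnorm_triangle : forall x y, fnval (x + y) <= fnval x + fnval y;
  fnorm_balanced : forall (a : R) x, `|a| <= 1 -> fnval (a *: x) <= fnval x;
  fnorm_absorbing : forall x (e : R), 0 < e ->
    exists2 k : R, 0 < k & forall a, `|a| < k -> fnval (a *: x) < e;
  fnorm_qconvex : forall (a b : R) x y, 0 <= a -> 0 <= b -> a + b = 1 ->
    fnval (a *: x + b *: y) <= Num.max (fnval x) (fnval y) }.

(** A copy of [E] that carries the topology of [N]. *)
Definition fnormed (R : realType) (E : lmodType R) (N : fnorm E) : Type := E.

HB.instance Definition _ (R : realType) (E : lmodType R) (N : fnorm E) :=
  GRing.Lmodule.on (fnormed N).

Section FNormTheory.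
Context (R : realType) (E : lmodType R) (N : fnorm E).

Lemma fnormN x : N (- x) = N x.
Proof.
have le y : N (- y) <= N y.
  by rewrite -scaleN1r; apply: fnorm_balanced; rewrite normrN normr1.
by apply/eqP; rewrite eq_le le /= -{1}(opprK x) le.
Qed.

Lemma fnorm_ge0 x : 0 <= N x.
Proof.
have : N (x - x) <= N x + N x by rewrite -{2}(fnormN x) fnorm_triangle.
have : N 0 <= N 0 + N 0 by rewrite -{1}(addr0 0) fnorm_triangle.
rewrite subrr; lra.
Qed.

Lemma fnorm0 : N 0 = 0.
Proof.
apply/eqP; rewrite eq_le fnorm_ge0 andbT leNgt; apply/negP => N0.
have [k k0 /(_ 0)] := fnorm_absorbing N 0 N0.
by rewrite normr0 scaler0 ltxx => /(_ k0).
Qed.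

Lemma fnormMn x n : N (x *+ n) <= N x *+ n.
Proof.
elim: n => [|n IH]; first by rewrite !mulr0n fnorm0.
by rewrite !mulrS (le_trans (fnorm_triangle _ _ _))// lerD2l.
Qed.

Lemma fnormZ_le (b : R) x n : (0 < n)%N -> `|b| <= n%:R -> N (b *: x) <= N x *+ n.
Proof.
move=> n0 bn; have n0R : 0 < n%:R :> R by rewrite ltr0n.
have -> : b *: x = (b / n%:R) *: (x *+ n).
  by rewrite -scaler_nat scalerA divfK// gt_eqF.
apply: le_trans (fnormMn x n); apply: fnorm_balanced.
by rewrite normrM normfV ler_pdivrMr ?normr_gt0 ?gt_eqF// mul1r (ger0_norm (ltW n0R)).
Qed.

Definition fdist (x y : fnormed N) : R := N (x - y).

Lemma fdistxx x : fdist x x = 0.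
Proof. by rewrite /fdist subrr fnorm0. Qed.

Lemma fdist_eq0 x y : fdist x y = 0 -> x = y.
Proof. by move=> /fnorm_eq0 /eqP; rewrite subr_eq0 => /eqP. Qed.

Lemma fdistC x y : fdist x y = fdist y x.
Proof. by rewrite /fdist -fnormN opprB. Qed.

Lemma fdist_triangle y x z : fdist x z <= fdist x y + fdist y z.
Proof.
rewrite /fdist (_ : x - z = (x - y) + (y - z)) ?fnorm_triangle//.
by rewrite addrA subrK.
Qed.

HB.instance Definition _ := isMetric.Build R (fnormed N)
  fdistxx fdist_eq0 fdistC fdist_triangle.

Lemma nbhs_fnormP (x : fnormed N) (U : set (fnormed N)) :
  nbhs x U <-> exists2 e : R, 0 < e & [set y | fdist x y < e] `<=` U.
Proof. exact: nbhs_ballP. Qed.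

Lemma fnormed_add_continuous :
  continuous (fun x : fnormed N * fnormed N => x.1 + x.2).
Proof.
move=> [x y] U /= /nbhs_fnormP[e e0 eU].
exists ([set z | fdist x z < e / 2], [set z | fdist y z < e / 2]).
  by split; apply/nbhs_fnormP; exists (e / 2) => //; rewrite divr_gt0.
move=> [x' y'] /= [xx' yy']; apply: eU => /=.
rewrite /fdist opprD addrACA (le_lt_trans (fnorm_triangle _ _ _))//.
by rewrite [e]splitr ltrD.
Qed.

Lemma fnormed_scale_continuous :
  continuous (fun z : R^o * fnormed N => z.1 *: z.2).
Proof.
move=> [a x] U /= /nbhs_fnormP[e e0 eU].
have e20 : 0 < e / 2 by rewrite divr_gt0.
have [k k0 ak] := fnorm_absorbing N x e20.
pose n := (Num.truncn (`|a| + k)).+1.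
have n0 : 0 < n%:R :> R by rewrite ltr0n.
exists ([set b : R^o | `|a - b| < k], [set z | fdist x z < e / 2 / n%:R]).
  split; first by apply/nbhs_ballP; exists k.
  by apply/nbhs_fnormP; exists (e / 2 / n%:R) => //; rewrite divr_gt0.
move=> [b y] /= [ab xy]; apply: eU => /=.
have -> : fdist (a *: x) (b *: y) = N ((a - b) *: x + b *: (x - y)).
  by rewrite /fdist scalerBl scalerBr addrA subrK.
rewrite (le_lt_trans (fnorm_triangle _ _ _))// [e]splitr ltrD//; first exact: ak.
rewrite ltr_pdivlMr// in xy.
apply: le_lt_trans xy; rewrite mulr_natr; apply: fnormZ_le => //.
apply: le_trans (ltW (truncnS_gt _)).
by rewrite -(subrKC a b) (le_trans (ler_normD _ _))// lerD2l distrC ltW.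
Qed.

Lemma fnormed_locally_convex : exists2 B : set_system (fnormed N),
  (forall b, b \in B -> convex_set b) & basis B.
Proof.
exists [set U | exists x e, U = [set y | fdist x y < e]].
  move=> U /[!inE] -[x [e ->]] y z l /[!inE] /= xy xz.
  apply: (@le_lt_trans _ _ (Num.max (fdist x y) (fdist x z))); last first.
    by rewrite gt_max xy xz.
  have l1 : l%:num + (1 - l%:num) = 1 by rewrite subrKC.
  rewrite /fdist (_ : x - _ = l%:num *: (x - y) + (1 - l%:num) *: (x - z)).
    by apply: fnorm_qconvex => //; rewrite subr_ge0.
  by rewrite !scalerBr addrACA -opprD -scalerDl l1 scale1r.
split=> [U [x [e ->]]|x U /nbhs_fnormP[e e0 eU]].
  rewrite openE => y /= xy; apply/nbhs_fnormP; exists (e - fdist x y).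
    by rewrite subr_gt0.
  move=> z /=; rewrite ltrBrDl; exact: le_lt_trans (fdist_triangle _ _ _).
exists [set y | fdist x y < e] => //; split; first by exists x, e.
by rewrite /= fdistxx.
Qed.

HB.instance Definition _ :=
  PreTopologicalNmodule_isTopologicalNmodule.Build (fnormed N)
    fnormed_add_continuous.
HB.instance Definition _ :=
  TopologicalNmodule_isTopologicalLmodule.Build R (fnormed N)
    fnormed_scale_continuous.
HB.instance Definition _ :=
  Uniform_isTvs.Build R (fnormed N) fnormed_locally_convex.

End FNormTheory.
Section FNormMetric.
Context (R : realType) (E : lmodType R) (N : fnorm E).

Lemma fdist_is_metric : is_metric (@fdist R E N).
Proof.
split; [|by move=> x y; split=> [/fdist_eq0//|->]; exact: fdistxx
  |exact: fdistC|by move=> x y z; exact: fdist_triangle].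
by move=> x y; exact: fnorm_ge0.
Qed.

Lemma fdist_induces_topology : induces_topology (@fdist R E N).
Proof. exact: nbhs_fnormP. Qed.

Lemma frechet_fnormed : complete_metric (@fdist R E N) -> frechet (fnormed N).
Proof.
move=> Nc; split; exists (@fdist R E N); split=> //;
  [exact: fdist_is_metric|exact: fdist_induces_topology
  |exact: fdist_is_metric|exact: fdist_induces_topology|].
by move=> x y z; rewrite /fdist opprD addrACA subrr addr0.
Qed.

Lemma fnormed_cvgP (T : Type) (F : set_system T) (FF : Filter F)
    (u : T -> fnormed N) (y : fnormed N) :
  (forall e : R, 0 < e -> \forall n \near F, fdist y (u n) < e) -> u @ F --> y.
Proof.
move=> uy U /nbhs_fnormP[e e0 eU].
by apply: filterS (uy e e0) => n yn; exact: eU.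
Qed.

End FNormMetric.

(** * Koethe sequence spaces *)

(** Products make the weights increasing in [j], and make the quotients of two
of them unbounded wherever some [c i] in between is. *)
Definition weight (I : Type) (c : nat -> I -> nat) (j : nat) (t : I) : nat :=
  (\prod_(i < j) (c i t).+1)%N.

Section KotheSpace.
Context (R : realType) (I : choiceType) (c : nat -> I -> nat).
Implicit Types (y z : I -> R) (t : I) (j : nat).

Local Notation w j t := ((weight c j t)%:R : R).

Lemma weight0 t : weight c 0 t = 1%N.
Proof. by rewrite /weight big_ord0. Qed.

Lemma weightS j t : weight c j.+1 t = (weight c j t * (c j t).+1)%N.
Proof. by rewrite /weight big_ord_recr. Qed.

Lemma weight_gt0 j t : (0 < weight c j t)%N.
Proof. by rewrite /weight prodn_gt0. Qed.

Lemma weight_le j k t : (j <= k)%N -> (weight c j t <= weight c k t)%N.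
Proof.
move/subnKC => <-; elim: (k - j)%N => [|i IH]; first by rewrite addn0.
by rewrite addnS weightS (leq_trans IH)// leq_pmulr.
Qed.

(** The F-norm of the increasing family of seminorms
[sup_t (weight c j t) * |y t|].  Truncating the [j]-th one at [1 / (j + 1)] makes
the supremum finite for all families, and makes its balls the balls of
finitely many of these seminorms. *)
Definition knorm y : R :=
  sup [set r | r = 0 \/ exists j t, r = Num.min j.+1%:R^-1 (w j t * `|y t|)].

Lemma knorm_le y (e : R) : 0 <= e ->
  (forall j t, Num.min j.+1%:R^-1 (w j t * `|y t|) <= e) -> knorm y <= e.
Proof.
move=> e0 le; apply: ge_sup; first by exists 0; left.
by move=> r [->//|[j [t ->]]].
Qed.

Lemma le_knorm y j t : Num.min j.+1%:R^-1 (w j t * `|y t|) <= knorm y.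
Proof.
apply: ub_le_sup; last by right; exists j, t.
exists 1 => r [->|[i [s ->]]]; first exact: ler01.
by rewrite ge_min invf_le1 ?ltr0n// ler1n.
Qed.

Lemma knorm_ge0 y : 0 <= knorm y.
Proof.
apply: ub_le_sup; last by left.
exists 1 => r [->|[i [s ->]]]; first exact: ler01.
by rewrite ge_min invf_le1 ?ltr0n// ler1n.
Qed.

Lemma knorm_weight y j t (e : R) : knorm y <= e -> e < j.+1%:R^-1 ->
  w j t * `|y t| <= e.
Proof.
move=> ye ej; have := le_trans (le_knorm y j t) ye.
by rewrite ge_min leNgt ej.
Qed.

Lemma knorm_small y j (e : R) : j.+1%:R^-1 <= e ->
  (forall t, w j t * `|y t| <= e) -> knorm y <= e.
Proof.
move=> je le; apply: knorm_le => [|i t].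
  by apply: le_trans je; rewrite invr_ge0.
rewrite ge_min; have [ij|ji] := leqP i j.
  apply/orP; right; apply: le_trans (le t).
  by rewrite ler_wpM2r// ler_nat weight_le.
apply/orP; left; apply: le_trans je.
by rewrite lef_pV2 ?posrE ?ltr0n// ler_nat ltnS ltnW.
Qed.

Definition kothe_pred : {pred I -> R} := [pred y |
  `[< forall j, exists M : R, forall t, w j t * `|y t| <= M >]].

Lemma kothe_submod_closed : submod_closed kothe_pred.
Proof.
split; first by apply/asboolP => j; exists 0 => t; rewrite normr0 mulr0.
move=> a y z /asboolP yP /asboolP zP; apply/asboolP => j.
have [M yM] := yP j; have [M' zM] := zP j.
exists (`|a| * M + M') => t.
rewrite (le_trans (ler_wpM2l _ (ler_normD _ _)))// mulrDr lerD//.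
by rewrite normrM mulrCA ler_wpM2l.
Qed.

HB.instance Definition _ := GRing.isSubmodClosed.Build R _ kothe_pred
  kothe_submod_closed.

Record kothe := Kothe { kfun :> I -> R; _ : kfun \in kothe_pred }.

HB.instance Definition _ := [isSub for kfun].
HB.instance Definition _ := [Choice of kothe by <:].
HB.instance Definition _ := [SubChoice_isSubLmodule of kothe by <:].

Lemma kfunD (x y : kothe) t : (x + y) t = x t + y t.
Proof. by []. Qed.

Lemma kfunN (x : kothe) t : (- x) t = - x t.
Proof. by []. Qed.

Lemma kfunZ (a : R) (x : kothe) t : (a *: x) t = a * x t.
Proof. by []. Qed.

Lemma kotheP (y : kothe) j : exists2 M : R, 0 < M & forall t, w j t * `|y t| <= M.
Proof.
case: y => y /= /asboolP /(_ j) [M yM]; exists (`|M| + 1).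
  by rewrite ltr_wpDl.
move=> t; apply: le_trans (yM t) _.
by rewrite (le_trans (ler_norm _))// lerDl.
Qed.

Lemma kothe_eq0 (x : kothe) : knorm x = 0 -> x = 0.
Proof.
move=> x0; apply/val_inj/funext => t /=.
have := le_knorm x 0 t; rewrite x0 weight0 mul1r invr1 ge_min ler10 /=.
by rewrite normr_le0 => /eqP.
Qed.

Lemma kothe_triangle (x y : kothe) : knorm (x + y) <= knorm x + knorm y.
Proof.
apply: knorm_le => [|j t]; first by rewrite addr_ge0 ?knorm_ge0.
apply: le_trans (lerD (le_knorm x j t) (le_knorm y j t)).
have k0 : 0 <= j.+1%:R^-1 :> R by rewrite invr_ge0.
rewrite kfunD.
have xy : w j t * `|x t + y t| <= w j t * `|x t| + w j t * `|y t|.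
  by rewrite -mulrDr ler_wpM2l ?ler_normD.
have u0 : 0 <= w j t * `|x t| by rewrite mulr_ge0.
have v0 : 0 <= w j t * `|y t| by rewrite mulr_ge0.
rewrite ge_min; move: k0 xy u0 v0.
move: (_^-1) (_ * `|_ + _|) (_ * `|x t|) (_ * `|y t|) => k p u v k0 xy u0 v0.
by rewrite /Num.min; case: ifPn => ku; case: ifPn => kv; apply/orP;
  rewrite -?leNgt in ku kv *; (left; lra) || (right; lra).
Qed.

Lemma kothe_balanced (a : R) (x : kothe) : `|a| <= 1 -> knorm (a *: x) <= knorm x.
Proof.
move=> a1; apply: knorm_le => [|j t]; first exact: knorm_ge0.
apply: le_trans (le_knorm x j t); rewrite kfunZ normrM mulrCA.
by rewrite le_min ge_min lexx /= ge_min ler_piMl ?mulr_ge0// orbT.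
Qed.

Lemma kothe_absorbing (x : kothe) (e : R) : 0 < e ->
  exists2 k : R, 0 < k & forall a, `|a| < k -> knorm (a *: x) < e.
Proof.
move=> /exists_invn[n ne]; have [M M0 xM] := kotheP x n.
have n0 : 0 < n.+1%:R^-1 :> R by rewrite invr_gt0.
exists (n.+1%:R^-1 / M) => [|a]; first by rewrite divr_gt0.
rewrite ltr_pdivlMr// => aM; apply: le_lt_trans ne.
apply: knorm_small => // t; apply: le_trans (ltW aM).
by rewrite kfunZ normrM mulrCA ler_wpM2l.
Qed.

Lemma kothe_qconvex (a b : R) (x y : kothe) : 0 <= a -> 0 <= b -> a + b = 1 ->
  knorm (a *: x + b *: y) <= Num.max (knorm x) (knorm y).
Proof.
move=> a0 b0 ab; apply: knorm_le => [|j t].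
  by rewrite le_max knorm_ge0.
rewrite kfunD !kfunZ.
have k0 : 0 <= j.+1%:R^-1 :> R by rewrite invr_ge0.
have xy : w j t * `|a * x t + b * y t| <=
    Num.max (w j t * `|x t|) (w j t * `|y t|).
  apply: le_trans (_ : a * (w j t * `|x t|) + b * (w j t * `|y t|) <= _).
    rewrite !(mulrCA _ (w j t)) -mulrDr ler_wpM2l// (le_trans (ler_normD _ _))//.
    by rewrite !normrM (ger0_norm a0) (ger0_norm b0).
  rewrite le_max; move: (w j t * `|x t|) (w j t * `|y t|) => u v.
  by have [uv|vu] := leP u v; apply/orP; [right|left]; nra.
have := le_knorm x j t; have := le_knorm y j t.
move: xy; rewrite !ge_min !le_max.
move: (_^-1) (_ * `|_ + _|) (_ * `|x t|) (_ * `|y t|) => k p u v.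
by move=> /orP[] xy /orP[] h1 /orP[] h2; apply/orP;
 rewrite ?h1 ?h2 ?orbT; auto; right; apply/orP;
 first [by left; lra | by right; lra].
Qed.

Definition kothe_fnorm : fnorm kothe := FNorm kothe_eq0 kothe_triangle
  kothe_balanced kothe_absorbing kothe_qconvex.

End KotheSpace.

(** * Koethe spaces that are Montel *)

Section KotheFrechet.
Context (R : realType) (I : choiceType) (c : nat -> I -> nat).

Local Notation w j t := ((weight c j t)%:R : R).
Local Notation kothe := (kothe R c).
Local Notation kspace := (fnormed (kothe_fnorm R c)).

Lemma weight_near (F : set_system kothe) (FF : ProperFilter F) (y : I -> R)
    (j : nat) (t : I) (e : R) : 0 < e ->
  (fun z : kothe => z t) @ F --> y t ->
  F [set z : kothe | w j t * `|z t - y t| <= e].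
Proof.
move=> e0 zy; have w0 : 0 < w j t by rewrite ltr0n weight_gt0.
have /cvgrPdist_le/(_ (e / w j t)) := zy.
rewrite divr_gt0// => /(_ isT); apply: filterS => z.
by rewrite distrC ler_pdivlMr// mulrC.
Qed.

Lemma pointwise_lim_kothe (F : set_system kothe) (FF : ProperFilter F)
    (y : I -> R) :
  (forall t, (fun z : kothe => z t) @ F --> y t) ->
  (forall j, exists M : R,
    F [set z : kothe | forall t, w j t * `|z t| <= M]) ->
  exists2 y' : kothe, y' = y :> (I -> R) & forall (j : nat) (M : R),
    F [set z : kothe | forall t, w j t * `|z t| <= M] ->
    forall t, w j t * `|y' t| <= M.
Proof.
move=> zy zM.
have yM (j : nat) (M : R) : F [set z : kothe | forall t, w j t * `|z t| <= M] ->
    forall t, w j t * `|y t| <= M.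
  move=> Mz t; apply/ler_addgt0Pr => e e0.
  have [z [zt zM']] := filter_ex (filterI (weight_near FF j e0 (zy t)) Mz).
  rewrite -(subrK (z t) (y t)) (le_trans (ler_wpM2l _ (ler_normD _ _)))//.
  by rewrite mulrDr addrC lerD// distrC.
have yP : y \in kothe_pred c.
  by apply/asboolP => j; have [M Mz] := zM j; exists M; exact: yM.
by exists (Kothe yP).
Qed.

Lemma knorm_pointwise_lim (F : set_system kothe) (FF : ProperFilter F)
    (x y : kothe) (e : R) :
  (forall t, (fun z : kothe => z t) @ F --> y t) ->
  F [set z : kothe | knorm c (x - z) <= e] -> knorm c (x - y) <= e.
Proof.
move=> zy xz; have e0 : 0 <= e.
  by have [z xz'] := filter_ex xz; apply: le_trans xz'; exact: knorm_ge0.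
apply: knorm_le => // j t; apply/ler_addgt0Pr => d d0.
have [z [zt xz']] := filter_ex (filterI (weight_near FF j d0 (zy t)) xz).
have {xz'} := le_trans (le_knorm c (x - z) j t) xz'.
have : w j t * `|(x - y) t| <= w j t * `|(x - z) t| + d.
  rewrite !kfunD !kfunN (_ : x t - y t = (x t - z t) + (z t - y t)); last ring.
  by rewrite (le_trans (ler_wpM2l _ (ler_normD _ _)))// mulrDr lerD.
rewrite !ge_min => h /orP[h1|h1]; apply/orP; [left|right].
  by rewrite (le_trans h1)// lerDl ltW.
by rewrite (le_trans h)// lerD2r.
Qed.

Lemma le_knorm1 (x : I -> R) t (e : R) : knorm c x <= e -> e < 1 -> `|x t| <= e.
Proof.
move=> xe e1; have := @knorm_weight R I c x 0 t e xe.
by rewrite weight0 invr1 mul1r; exact.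
Qed.

(** The coordinates of a Cauchy sequence converge, and an inequality for [knorm]
passes to pointwise limits. *)
Lemma kspace_frechet : frechet kspace.
Proof.
apply: frechet_fnormed => u uC.
pose F : set_system kothe := (u : nat -> kothe) @ \oo.
have FF : ProperFilter F by exact: fmap_proper_filter.
have FE e : 0 < e -> exists N, forall n, (N <= n)%N ->
    F [set z : kothe | knorm c ((u n : kothe) - z) <= e].
  move=> /uC[N uN]; exists N => n Nn; exists N => // m Nm; exact/ltW/uN.
have /choice[y zy] t : exists l : R, (fun z : kothe => z t) @ F --> l.
  apply/cvg_ex/cauchy_cvgP/cauchy_exP => e e0.
  pose d : R := Num.min (e / 2) (1 / 2).
  have d0 : 0 < d by rewrite lt_min !divr_gt0.
  have de : d < e by rewrite gt_min; apply/orP; left; lra.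
  have d1 : d < 1 by rewrite gt_min; apply/orP; right; lra.
  have [N uN] := FE _ d0; exists ((u N : kothe) t).
  apply: filterS (uN N (leqnn N)) => z /= zN.
  have zt : `|(u N : kothe) t - z t| <= d := le_knorm1 t zN d1.
  exact: (le_lt_trans zt de).
have [|y' y'E _] := @pointwise_lim_kothe F FF y zy.
  move=> j; have k0 : 0 < j.+2%:R^-1 :> R by rewrite invr_gt0.
  have [N /(_ N (leqnn N)) uN] := FE _ k0.
  have [M M0 uM] := kotheP (u N : kothe) j.
  exists (M + j.+2%:R^-1); apply: filterS uN => z /= zN t.
  have jj : j.+2%:R^-1 < j.+1%:R^-1 :> R by rewrite ltf_pV2 ?posrE ?ltr0n// ltr_nat.
  have zN' : w j t * `|(u N : kothe) t - z t| <= j.+2%:R^-1 := knorm_weight t zN jj.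
  rewrite (_ : z t = (u N : kothe) t - ((u N : kothe) t - z t)); last by ring.
  by rewrite (le_trans (ler_wpM2l _ (ler_normB _ _)))// mulrDr lerD.
exists y'; apply: fnormed_cvgP => e e0.
have e20 : 0 < e / 2 by rewrite divr_gt0.
have [N uN] := FE _ e20; exists N => // n /= /uN un.
suff : fdist (u n) (y' : kspace) < e by rewrite fdistC.
apply: (@le_lt_trans _ _ (e / 2)); last lra.
by apply: knorm_pointwise_lim un => t; rewrite y'E.
Qed.

(** The Dieudonne-Gomes criterion for Koethe echelon spaces, in terms of the
functions [c i], whose successors are the quotients of consecutive weights. *)
Definition montel_weights := forall (k : nat) (S : set I),
  (forall i, (k <= i)%N -> exists B : nat, forall t, S t -> (c i t <= B)%N) ->
  finite_set S.

(** Bounded coordinates lie in a compact segment. *)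
Lemma ultra_pointwise_cvg (F : set_system kothe) (FU : UltraFilter F) t (M : R) :
  F [set z : kothe | `|z t| <= M] -> exists l : R, (fun z : kothe => z t) @ F --> l.
Proof.
move=> FM.
have {}FM : F ((fun z : kothe => z t) @^-1` `[- M, M]).
  by apply: filterS FM => z /=; rewrite in_itv /= -ler_norml.
have [] := @segment_compact R (- M) M ((fun z : kothe => z t) @ F)
  (fmap_proper_filter _ _) FM.
move=> l [_ lF]; exists l => U lU.
have [//|FnU] := in_ultra_setVsetC ((fun z : kothe => z t) @^-1` U) FU.
by have [? []] := lF (~` U) U FnU lU.
Qed.

(** A bounded set lies in a box given by bounds [M j] on all the weighted
coordinates, so that an ultrafilter on it has a pointwise limit.  Convergence
for the [n]-th seminorm is uniform: the coordinates where an element of the set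
can be far from the limit for this seminorm make every [c i] with [n <= i]
bounded, hence there are finitely many of them. *)
Lemma kspace_montel : montel_weights -> montel kspace.
Proof.
move=> cM; split; first exact: kspace_frechet.
move=> K Kcl Kb.
have /choice[M KM] j : exists M : R,
    forall x, K x -> forall t, w j t * `|(x : kothe) t| <= M.
  have j0 : 0 < j.+1%:R^-1 :> R by rewrite invr_gt0.
  have [|a Ka] := Kb [set x | fdist 0 x < j.+2%:R^-1].
    by apply/nbhs_fnormP; exists j.+2%:R^-1 => //; rewrite invr_gt0.
  exists (`|a| * j.+2%:R^-1) => x /Ka[z z0 <- t].
  have : fdist z (0 : kspace) < j.+2%:R^-1 by rewrite fdistC.
  rewrite /fdist subr0 => zj.
  rewrite kfunZ normrM mulrCA ler_wpM2l//.
  apply: (knorm_weight t (ltW zj)).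
  by rewrite ltf_pV2 ?posrE ?ltr0n// ltr_nat.
rewrite compact_ultra => F FU FK.
have /choice[y zy] t : exists l : R, (fun z : kothe => z t) @ F --> l.
  apply: (@ultra_pointwise_cvg F FU t (M 0%N)); apply: filterS FK => z Kz /=.
  by have := KM 0%N z Kz t; rewrite weight0 mul1r.
have [|y' y'E yM] := @pointwise_lim_kothe F _ y zy.
  by move=> j; exists (M j); apply: filterS FK => z Kz s; exact: (KM _ _ Kz).
have {}yM j t : w j t * `|y' t| <= M j.
  by apply: yM; apply: filterS FK => z Kz s; exact: (KM _ _ Kz).
have Fy : F --> (y' : kspace).
  apply: (@fnormed_cvgP R _ _ _ F _ id) => e /exists_invn[n ne].
  have n0 : 0 < n.+1%:R^-1 :> R by rewrite invr_gt0.
  pose S := [set t | exists2 x : kspace, K x &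
    n.+1%:R^-1 < w n t * `|(x : kothe) t - y' t|].
  have Sfin : finite_set S.
    apply: (cM n) => i ni; exists (Num.truncn (n.+1%:R * (M i.+1 + M i.+1))).
    move=> t [x Kx xt].
    have xy : w i.+1 t * `|(x : kothe) t - y' t| <= M i.+1 + M i.+1.
      rewrite (le_trans (ler_wpM2l _ (ler_normB _ _)))// mulrDr lerD//.
      exact: KM.
    have wi : w n t * (c i t).+1%:R <= w i.+1 t.
      by rewrite weightS natrM ler_wpM2r// ler_nat weight_le.
    have ci : (c i t)%:R <= n.+1%:R * (M i.+1 + M i.+1).
      rewrite -ler_pdivrMl//; apply: le_trans xy.
      apply: le_trans (ler_wpM2r (normr_ge0 _) wi).
      rewrite mulrAC; apply: ler_pM => //; [exact: ltW|by rewrite ler_nat].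
    by rewrite truncn_ge_nat// (le_trans _ ci).
  have FS : F [set z : kothe | forall t, S t -> w n t * `|z t - y' t| <= n.+1%:R^-1].
    apply: filter_finite_forall => // t _.
    by apply: weight_near => //; rewrite y'E.
  apply: filterS (filterI FK FS) => z [Kz Sz].
  suff : fdist (z : kspace) (y' : kspace) < e by rewrite fdistC.
  apply: le_lt_trans ne.
  apply: knorm_small => // t.
  have [/Sz//|/forall2NP/(_ z)[//|]] := pselect (S t).
  by move/negP; rewrite -leNgt.
exists y'; split => //; apply: Kcl => U /Fy FU'.
exact: filter_ex (filterI FK FU').
Qed.

End KotheFrechet.

(** * Bounded sequences and separability in Montel spaces *)

Section BalancedBase.
Context (R : realType) (E : tvsType R).

(** The multiple [(m + 1) W n]; the successor keeps the scalar invertible. *)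
Definition dilate (W : nat -> set E) (n m : nat) : set E :=
  [set x | W n (m.+1%:R^-1 *: x)].

Record balanced_base (W : nat -> set E) : Prop := BalancedBase {
  bbase_nbhs : forall n, nbhs 0 (W n);
  bbase_balanced : forall n (a : R) x, `|a| <= 1 -> W n x -> W n (a *: x);
  bbase_add : forall n x y, W n.+1 x -> W n.+1 y -> W n (x + y);
  bbase_sub : forall U : set E, nbhs 0 U -> exists n, W n `<=` U }.

(** The set of all [x] whose multiples by scalars of modulus at most [1] stay in
a small neighbourhood is balanced; it is a neighbourhood because scaling is
continuous at [(0, 0)]. *)
Lemma balanced_half (U : set E) : nbhs 0 U ->
  exists V : set E, [/\ nbhs 0 V,
    forall (a : R) x, `|a| <= 1 -> V x -> V (a *: x),
    V `<=` U & forall x y, V x -> V y -> U (x + y)].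
Proof.
move=> U0; have := @add_continuous E (0, 0) U; rewrite /= addr0 => /(_ U0).
move=> [[A B] /= [A0 B0] AB].
have C0 : nbhs (0 : E) (A `&` B) by exact: filterI.
have := @scale_continuous R E (0, 0) (A `&` B); rewrite /= scaler0 => /(_ C0).
move=> [[P Q] /= [P0 Q0] PQ].
have [e /= e0 eP] : nbhs_ball (0 : R^o) P by apply/nbhs_ballP.
have e20 : e / 2 != 0 by rewrite mulf_neq0 ?gt_eqF// invr_eq0.
exists [set x | forall a : R, `|a| <= 1 -> (A `&` B) (a *: x)]; split.
- apply: filterS (nbhs0Z e20 Q0) => _ [x Qx <-] a a1.
  rewrite scalerA; apply: (PQ (a * (e / 2), x)); split => //=.
  apply: eP; rewrite /ball /= sub0r normrN normrM (gtr0_norm (divr_gt0 e0 _))//.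
  by rewrite (@le_lt_trans _ _ (e / 2))// ?ler_piMl ?divr_ge0// ?ltW//; lra.
- move=> a x a1 Vx b b1; rewrite scalerA; apply: Vx.
  by rewrite normrM mulr_ile1.
- move=> x /(_ 1); rewrite normr1 scale1r => /(_ (lexx _))[Ax _].
  by have := AB (x, 0); rewrite /= addr0; apply; split => //=;
    exact: nbhs_singleton.
- move=> x y /(_ 1) + /(_ 1); rewrite normr1 !scale1r.
  by move=> /(_ (lexx _))[Ax _] /(_ (lexx _))[_ By]; apply: (AB (x, y)).
Qed.

Lemma exists_balanced_base : invariantly_metrizable E ->
  exists W, balanced_base W.
Proof.
move=> [d [[d_ge0 d_eq0 _ _] dtop _]].
pose B n := [set x : E | d 0 x < n.+1%:R^-1].
have B0 n : nbhs 0 (B n).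
  by apply/dtop; exists n.+1%:R^-1 => //; rewrite invr_gt0.
have /choice[bal balP] (U : set E) : exists V : set E, nbhs 0 U ->
    [/\ nbhs 0 V, forall (a : R) x, `|a| <= 1 -> V x -> V (a *: x),
    V `<=` U & forall x y, V x -> V y -> U (x + y)].
  have [/balanced_half[V VP]|nU] := pselect (nbhs 0 U); first by exists V.
  by exists set0.
pose W := fix W n := bal (if n is m.+1 then W m `&` B n else B 0%N).
have W0 n : nbhs 0 (W n).
  by elim: n => [|n IH] /=; [have [] := balP _ (B0 0%N)
    |have [] := balP _ (filterI IH (B0 n.+1))].
have WP n : [/\ nbhs 0 (W n.+1),
    forall (a : R) x, `|a| <= 1 -> W n.+1 x -> W n.+1 (a *: x),
    W n.+1 `<=` W n `&` B n.+1 &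
    forall x y, W n.+1 x -> W n.+1 y -> (W n `&` B n.+1) (x + y)].
  exact: balP (filterI (W0 n) (B0 n.+1)).
exists W; split => //.
- by case=> [|n]; [have [] := balP _ (B0 0%N)|have [] := WP n].
- by move=> n x y Wx Wy; have [_ _ _ /(_ x y Wx Wy)[]] := WP n.
- move=> U /dtop[e e0 eU].
  have [n ne] := exists_invn e0; exists n.+1 => x.
  have [_ _ + _] := WP n => /[apply] -[_ Bx]; apply: eU => /=.
  apply: lt_trans Bx _; apply: le_lt_trans ne.
  by rewrite lef_pV2 ?posrE ?ltr0n// ler_nat.
Qed.

Section Theory.
Context (W : nat -> set E) (WP : balanced_base W).

Lemma bbase0 n : W n 0.
Proof. exact: nbhs_singleton (bbase_nbhs WP n). Qed.

Lemma bbaseN n x : W n x -> W n (- x).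
Proof.
by move=> Wx; rewrite -scaleN1r; apply: (bbase_balanced WP) => //; rewrite normrN1.
Qed.

Lemma bbaseC n x y : W n (x - y) -> W n (y - x).
Proof. by move=> /bbaseN; rewrite opprB. Qed.

Lemma bbase_le m n : (m <= n)%N -> W n `<=` W m.
Proof.
move/subnKC => <-; elim: (n - m)%N => [|k IH]; first by rewrite addn0.
rewrite addnS => x Wx; apply: IH; rewrite -(addr0 x).
by apply: (bbase_add WP) => //; exact: bbase0.
Qed.

Lemma nbhs_bbase x (n : nat) : nbhs x [set y | W n (x - y)].
Proof.
have := nbhsT x (bbase_nbhs WP n); apply: filterS => _ [z Wz <-] /=.
by rewrite opprD addrA subrr add0r; exact: bbaseN.
Qed.

Lemma dilate_le n m m' : (m <= m')%N -> dilate W n m `<=` dilate W n m'.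
Proof.
move=> mm x Wx; rewrite /dilate /=.
have -> : m'.+1%:R^-1 = (m'.+1%:R^-1 * m.+1%:R) * m.+1%:R^-1 :> R.
  by rewrite -mulrA divff ?mulr1// pnatr_eq0.
rewrite -scalerA; apply: (bbase_balanced WP) => //.
by rewrite ger0_norm ?mulr_ge0// ler_pdivrMl// mulr1 ler_nat.
Qed.

Lemma exists_dilate n x : exists m, dilate W n m x.
Proof.
have := @scale_continuous R E (0, x) (W n); rewrite /= scale0r.
move=> /(_ (bbase_nbhs WP n))[[P Q] /= [P0 Q0] PQ].
have [e /= e0 eP] : nbhs_ball (0 : R^o) P by apply/nbhs_ballP.
have [m me] := exists_invn e0; exists m; apply: (PQ (m.+1%:R^-1, x)); split => /=.
  by apply: eP; rewrite /ball /= sub0r normrN ger0_norm ?invr_ge0.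
exact: nbhs_singleton.
Qed.

(** Approximation costs one index but leaves the multiplier unchanged. *)
Lemma dilate_perturb n m x y : dilate W n.+1 m x -> W n.+1 (y - x) ->
  dilate W n m y.
Proof.
move=> Wx Wyx; rewrite /dilate /= -(subrKC x y) scalerDr.
apply: (bbase_add WP) => //; apply: (bbase_balanced WP) => //.
by rewrite ger0_norm ?invr_ge0// invf_le1 ?ltr0n// ler1n.
Qed.

(** Each [W n] absorbs the finitely many terms before the tail. *)
Lemma dilate_tail n (u : nat -> E) (k m : nat) :
  (forall i, (k <= i)%N -> dilate W n m (u i)) ->
  exists m', forall i, dilate W n m' (u i).
Proof.
elim: k m => [|k IH] m um; first by exists m => i; exact: um.
have [p up] := exists_dilate n (u k).
apply: (IH (maxn m p)) => i; rewrite leq_eqVlt => /predU1P[<-|ki].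
  by apply: dilate_le up; exact: leq_maxr.
by apply: dilate_le (um _ ki); exact: leq_maxl.
Qed.

(** Closing the range keeps it bounded, so it becomes compact; around a cluster
point, two terms of arbitrarily large indices are close to each other. *)
Lemma montel_no_separated_bounded (N : nat) (u : nat -> E) : montel E ->
  (forall n, exists m, forall i, (n <= i)%N -> dilate W n m (u i)) ->
  (forall i j, (i < j)%N -> ~ W N (u i - u j)) -> False.
Proof.
move=> [_ HB] ub us.
have Kb : tvs_bounded (closure (range u)).
  move=> U /(bbase_sub WP)[n nU].
  have [m um] := ub n.+1; have [m' {}um] := dilate_tail um.
  exists m'.+1%:R => x /(_ _ (nbhs_bbase x n.+1))[_ [[i _ <-] xui]].
  exists (m'.+1%:R^-1 *: x); first exact/nU/(dilate_perturb (um i)).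
  by rewrite scalerA divff ?scale1r// pnatr_eq0.
have [|x [_ ux]] := HB _ (@closed_closure _ _) Kb (u @ \oo) _.
  by exists 0%N => // i _; apply: subset_closure; exists i.
have tail k : (u @ \oo) [set y | exists2 i, (k <= i)%N & y = u i].
  by exists k => // i ki; exists i.
have [_ [[i _ ->] xi]] := ux _ _ (tail 0%N) (nbhs_bbase x N.+1).
have [_ [[j ij ->] xj]] := ux _ _ (tail i.+1) (nbhs_bbase x N.+1).
apply: (us i j ij); rewrite (_ : u i - u j = (u i - x) + (x - u j)).
  by apply: (bbase_add WP) => //; exact: bbaseC.
by rewrite addrA subrK.
Qed.

(** Dieudonne's theorem that Montel spaces are separable.  Call a set small if
countably many translates of [W N] cover it.  If the whole space is not small,
then, since it is the union of the multiples of each [W j] and countable unions of small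
sets are small, multipliers [m j] can be chosen one after the other so that no
finite intersection of the sets [dilate W j (m j)] is small.  In particular, finitely many
translates of [W N] never cover such an intersection, and this yields a
bounded separated sequence. *)
Lemma montel_countable_net : montel E ->
  exists D : nat -> E, forall x n, exists p, W n (x - D p).
Proof.
move=> EM.
suff /choice[D DP] : forall n, exists D : nat -> E, forall x, exists p, W n (x - D p).
  exists (fun q => if unpickle q is Some (n, p) then D n p else 0) => x n.
  by have [p xp] := DP n x; exists (pickle (n, p)); rewrite pickleK.
move=> N; pose small (S : set E) :=
  exists D : nat -> E, forall x, S x -> exists p, W N (x - D p).
suff [D DP] : small setT by exists D => x; exact: DP.
apply: contrapT => nsmall.
have small_bigcup (S : nat -> set E) :
    (forall k, small (S k)) -> small (\bigcup_k S k).
  move=> /choice[D DP].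
  exists (fun q => if unpickle q is Some (n, p) then D n p else 0) => x [n _].
  by move=> /DP[p xp]; exists (pickle (n, p)); rewrite pickleK.
pose box s := [set x | forall j, (j < size s)%N -> dilate W j (nth 0%N s j) x].
have [s|m mP] := @history_choice nat
    (fun s m => ~ small (box s) -> ~ small (box (rcons s m))).
  have [sm|nsm] := pselect (small (box s)); first by exists 0%N.
  apply: contrapT => /forallNP nm; apply: nsm.
  have /small_bigcup[D DP] k : small (box (rcons s k)).
    by apply: contrapT => h; apply: (nm k).
  exists D => x sx; apply: DP; have [p xp] := exists_dilate (size s) x.
  exists p => // j; rewrite size_rcons ltnS nth_rcons leq_eqVlt.
  by case: ltngtP => // [/sx//|->].
have {mP} boxP n : ~ small (box (mkseq m n)).
  elim: n => [|n IH]; last by rewrite mkseqS; exact: mP.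
  by move=> [D DP]; apply: nsmall; exists D => x _; exact: DP.
have [s|u uP] := @history_choice E (fun s x =>
    box (mkseq m (size s).+1) x /\ forall y, y \in s -> ~ W N (y - x)).
  apply: contrapT => /forallNP nx; apply: (boxP (size s).+1).
  exists (nth 0 s) => x bx; apply: contrapT => /forallNP xs.
  apply: (nx x); split => // y /(nthP 0)[i _ <-] /bbaseC; exact: xs.
apply: (@montel_no_separated_bounded N u EM).
  move=> n; exists (m n) => i ni; have [+ _] := uP i.
  by rewrite !size_mkseq => /(_ n); rewrite size_mkseq ltnS nth_mkseq// => /(_ ni).
move=> i j ij; have [_ +] := uP j; apply.
by apply/mapP; exists i => //; rewrite mem_iota.
Qed.

End Theory.

Lemma montel_separable : montel E -> separable_space E.
Proof.
move=> EM; have [W WP] := exists_balanced_base (proj2 (proj1 EM)).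
have [D DP] := montel_countable_net WP EM.
exists (range D); first exact: card_image_le.
move=> O [x Ox] Oo.
have := nbhsB (- x) (open_nbhs_nbhs (conj Oo Ox)); rewrite addNr.
move=> /(bbase_sub WP)[n nO]; have [p /(bbaseC WP)/nO[z Oz]] := DP x n.
rewrite [LHS]addrC => /addIr zp; exists (D p); split; last by exists p.
by rewrite -zp.
Qed.

End BalancedBase.

(** * Montel weights from trees without infinite branch *)

Section TreeWeights.
Context (A : countType) (l : A -> nat) (T : set (seq A)).
Implicit Types (s t r : seq A).

(** The shortest initial segment of [t] that ends with an entry of level at least
[j], and [t] itself if there is no such entry. *)
Definition cut j t := take (find (fun e => j <= l e)%N t).+1 t.

(** Outside the tree the whole sequence is coded, so that a bound on the codes
leaves only finitely many sequences there. *)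
Definition tree_code j t : nat := pickle (if `[< T t >] then cut j t else t).

Lemma tree_codeT j t : T t -> tree_code j t = pickle (cut j t).
Proof. by rewrite /tree_code => /asboolT ->. Qed.

Lemma cut_cat j s r : has (fun e => j <= l e)%N s -> cut j (s ++ r) = cut j s.
Proof.
by move=> js; rewrite /cut find_cat js takel_cat// -has_find.
Qed.

Lemma cut_extends j s e r : (forall a, a \in s -> (l a < j)%N) ->
  prefix (rcons s e) (cut j (s ++ e :: r)).
Proof.
move=> js; have /negPf hs : ~~ has (fun e => j <= l e)%N s.
  by apply/hasPn => a /js; rewrite ltnNge.
rewrite /cut find_cat hs -addnS takeD take_size_cat// drop_size_cat//=.
by rewrite -cat_rcons prefix_prefix.
Qed.

(** Koenig's lemma.  Suppose that infinitely many nodes of [S] extend [s].  Once [j]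
exceeds all the levels in [s], the segment [cut j t] of such a node [t] goes
strictly beyond [s], except for [t = s]; as it takes finitely many
values, infinitely many nodes of [S] extend [s] by the same entry.  Iterating
from the empty node gives an infinite branch. *)
Lemma tree_code_montel :
  (forall s r, T (s ++ r) -> T s) ->
  (forall u : nat -> A, exists n, ~ T (mkseq u n)) ->
  montel_weights tree_code.
Proof.
move=> Tprefix Tbranch k S Sbd; apply: contrapT => Sinf.
pose above s := S `&` T `&` [set t | prefix s t].
have base : infinite_set (above [::]).
  move=> fin; apply: Sinf; have [B SB] := Sbd k (leqnn k).
  apply: (@sub_finite_set _ _ (above [::] `|` [set t | (pickle t <= B)%N])).
    move=> t St; have [Tt|nTt] := pselect (T t).
      by left; split => //=; exact: prefix0s.
    by right; have := SB t St; rewrite /tree_code (asboolF nTt).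
  by rewrite finite_setU; split=> //; exact: finite_pickle_le.
have [t0 [_ t0N]] := infinite_setN0 (infinite_setD base (finite_set1 [::])).
case: t0 t0N => [/(_ erefl)//|a0 _ _].
have step s : exists e, infinite_set (above s) -> infinite_set (above (rcons s e)).
  have [inf|fin] := pselect (infinite_set (above s)); last first.
    by exists a0.
  (* The cut at i sees at least one entry after s. *)
  pose i := maxn k (\max_(a <- s) l a).+1.
  have [B SB] := Sbd i (leq_maxl _ _).
  have [|b binf] := infinite_fiber inf (h := tree_code i) (B := B).
    by move=> t [[St _] _]; exact: SB.
  have [t [[[[St Tt] /prefixP[[|e r] tE]] tb] ts]] :
      (above s `&` [set t | tree_code i t = b] `\ s) !=set0.
    by apply: infinite_setN0; exact: infinite_setD.
  - by case: ts; rewrite tE cats0.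
  exists e => _; apply: sub_infinite_set binf => t' [[[St' Tt'] _] t'b].
  split => //=.
  apply: prefix_trans (prefix_take t' _ : prefix (cut i t') t').
  have <- : cut i t = cut i t'.
    by apply: (pcan_inj pickleK); rewrite -!tree_codeT// tb t'b.
  rewrite tE; apply: cut_extends => a sa.
  by rewrite leq_max; apply/orP; right; rewrite ltnS; exact: leq_bigmax_seq.
have [u uP] := history_choice step.
have uinf n : infinite_set (above (mkseq u n)).
  by elim: n => [//|n IH]; rewrite mkseqS; exact: uP.
have [n nT] := Tbranch u; apply: nT.
have [t [[_ Tt] /prefixP[r tE]]] := infinite_setN0 (uinf n).
by apply: (Tprefix _ r); rewrite -tE.
Qed.

End TreeWeights.

(** * The diagonal argument *)

Section KotheBasis.
Context (R : realType) (I : choiceType) (c : nat -> I -> nat).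

Lemma kunit_subproof (t : I) :
  (fun s => (s == t)%:R : R) \in kothe_pred c.
Proof.
apply/asboolP => j; exists (weight c j t)%:R => s.
by case: eqVneq => [->|_]; rewrite ?normr1 ?normr0 ?mulr1 ?mulr0.
Qed.

Definition kunit t : fnormed (kothe_fnorm R c) := Kothe (kunit_subproof t).

Lemma kunit_separated s t : s != t -> 1 <= fdist (kunit s) (kunit t).
Proof.
move=> st; apply: le_trans (le_knorm c _ 0 s).
by rewrite weight0 invr1 mul1r /= !fctE eqxx (negPf st) subr0 normr1 minxx.
Qed.

Lemma knorm_scale_kunit (n : nat) (a e : R) t : n.+1%:R^-1 <= e ->
  (weight c n t)%:R * `|a| <= e ->
  fdist (0 : fnormed (kothe_fnorm R c)) (a *: kunit t) <= e.
Proof.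
move=> ne ae; rewrite fdistC /fdist subr0; apply: knorm_small ne _ => s.
have e0 : 0 <= e by apply: le_trans ae; rewrite mulr_ge0.
rewrite kfunZ /=; case: eqVneq => [->|_]; rewrite ?mulr1//.
by rewrite mulr0 normr0 mulr0.
Qed.

End KotheBasis.

Section NoEmbedding.
Context (R : realType) (X : tvsType R) (W : nat -> set X).
Context (WP : balanced_base W) (D : nat -> X).
Context (DP : forall x n, exists p, W n (x - D p)).

(** An entry of an attempt: the index of a point of [D], a bound for the points
to come, and a level. *)
Let entry : countType := (nat * nat * nat)%type.
Let point_ (e : entry) := D e.1.1.
Let mult (e : entry) := e.1.2.
Let level (e : entry) := e.2.

(** The entry [j] bounds, with respect to [W j], all the points of index [i >= j].
The entry at index [0] serves to announce, by its level, the neighbourhood that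
separates the points; this is why the indices start at [1]. *)
Definition bounded_separated_at (u : nat -> entry) i :=
  (forall j, (0 < j <= i)%N -> dilate W j (mult (u j)) (point_ (u i))) /\
  (forall j, (0 < j < i)%N -> ~ W (level (u 0%N)) (point_ (u j) - point_ (u i))).

Definition test_tree : set (seq entry) := [set t |
  forall i, (i < size t)%N -> bounded_separated_at (nth (0, 0, 0)%N t) i].

Lemma eq_bounded_separated_at (u v : nat -> entry) i :
  (forall j, (j <= i)%N -> u j = v j) ->
  bounded_separated_at u i -> bounded_separated_at v i.
Proof.
move=> uv [ub us]; split=> j /andP[j0 ji].
  by rewrite -!uv//; apply: ub; rewrite j0.
by rewrite -!uv// ?(ltnW ji)//; apply: us; rewrite j0.
Qed.

Lemma test_tree_mkseq (u : nat -> entry) n :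
  test_tree (mkseq u n) <-> forall i, (i < n)%N -> bounded_separated_at u i.
Proof.
rewrite /test_tree /= size_mkseq.
split=> uT i ni; apply: eq_bounded_separated_at (uT i ni) => j ji.
  by rewrite nth_mkseq// (leq_ltn_trans ji).
by rewrite nth_mkseq// (leq_ltn_trans ji).
Qed.

Lemma test_tree_prefix s r : test_tree (s ++ r) -> test_tree s.
Proof.
move=> sr i si; have := sr i; rewrite size_cat ltn_addr// => /(_ isT).
apply: eq_bounded_separated_at => j ji.
by rewrite nth_cat (leq_ltn_trans ji si).
Qed.

Lemma test_tree_no_branch (XM : montel X) (u : nat -> entry) :
  exists n, ~ test_tree (mkseq u n).
Proof.
apply/existsNP => uT.
have {}uT i : bounded_separated_at u i by exact: (test_tree_mkseq u i.+1).1.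
apply: (@montel_no_separated_bounded _ _ _ WP (level (u 0%N))
  (fun i => point_ (u i.+1)) XM).
  move=> n; exists (mult (u n.+1)) => i ni.
  apply: (bbase_le WP (leqnSn n)).
  by have [+ _] := uT i.+1; apply; rewrite ltnS.
by move=> i j ij; have [_ +] := uT j.+1; apply; rewrite ltnS.
Qed.

Definition test_code := tree_code level test_tree.

Lemma test_code_montel : montel X -> montel_weights test_code.
Proof.
move=> XM; apply: tree_code_montel; first exact: test_tree_prefix.
exact: test_tree_no_branch.
Qed.

Local Notation Y := (fnormed (kothe_fnorm R test_code)).

(** With respect to [W n], the image of a unit vector is controlled by one of its
weights, namely by the seminorm that continuity of [f] at [0] provides. *)
Lemma continuous_dilate (f : {linear Y -> X}) : continuous f ->
  exists sigma : nat -> nat, forall n t,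
    dilate W n (weight test_code (sigma n) t * (sigma n).+1) (f (kunit R test_code t)).
Proof.
move=> fc; suff /choice[sigma sigmaP] : forall n, exists k, forall t,
    dilate W n (weight test_code k t * k.+1) (f (kunit R test_code t)).
  by exists sigma.
move=> n.
have := fc 0 (W n); rewrite linear0 => /(_ (bbase_nbhs WP n)).
move=> /nbhs_fnormP[e /exists_invn[k ke] eW]; exists k => t.
set m := (_ * _)%N; rewrite /dilate /= -linearZ; apply: eW.
apply: le_lt_trans ke; apply: knorm_scale_kunit (lexx _) _.
rewrite ger0_norm ?invr_ge0// ler_pdivrMr// ler_pdivlMl//.
by rewrite -natrM ler_nat mulnC leqnSn.
Qed.

Lemma inverse_continuous_separated (F : set X) (f : {linear Y -> X}) (g : X -> Y) :
  range f = F -> cancel f g -> {within F, continuous g} ->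
  exists N, forall s t, s != t ->
    ~ W N (f (kunit R test_code s) - f (kunit R test_code t)).
Proof.
move=> fF gK gc.
have F0 : F 0 by rewrite -fF; exists 0 => //; rewrite linear0.
have g0 : g 0 = 0 by rewrite -(gK 0) linear0.
have g1 : nbhs (g 0) [set y | fdist 0 y < 1].
  by rewrite g0; apply/nbhs_fnormP; exists 1.
move/subspace_continuousP: gc => /(_ 0 F0 _ g1) /(bbase_sub WP)[N NF].
exists N => s t st; rewrite -linearB => /NF /= h.
have : fdist (0 : Y) (g (f (kunit R test_code s - kunit R test_code t))) < 1.
  by apply: h; rewrite -fF; eexists.
rewrite gK fdistC /fdist subr0; apply/negP; rewrite -leNgt.
exact: kunit_separated.
Qed.

(** Continuity of [f] is quantified by [sigma], and continuity of its inverse by [N].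
The recursion chooses the bound of the [k]-th entry for [W k.+1] rather
than [W k], to leave room for the approximation of [z t] by a point of [D].
The level of the entry before it is at least [s k = sigma k.+1], so the weight
giving this bound is the same at all later nodes. *)
Lemma no_embedding (XM : montel X) (F : set X) : ~ tvs_isomorphic_onto Y F.
Proof.
move=> [f [g [fF gK fc gc]]].
have [sigma sigmaP] := continuous_dilate fc.
have [N NP] := inverse_continuous_separated fF gK gc.
pose z t := f (kunit R test_code t).
pose s k := sigma k.+1.
(* The level is at least N + 2 since three perturbations by W (N + 2) stay in W N. *)
have [t|u uP] := @history_choice entry (fun t e =>
    [/\ W (maxn (size t) N).+2 (z t - point_ e),
      mult e = (weight test_code (s (size t)) t * (s (size t)).+1)%N &
      level e = maxn (s (size t).+1) N.+2]).
  have [p pz] := DP (z t) (maxn (size t) N).+2.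
  by exists (p, (weight test_code (s (size t)) t * (s (size t)).+1)%N,
    maxn (s (size t).+1) N.+2).
pose t n := mkseq u n.
have {uP} [approx multE levelE] : [/\ forall n, W (maxn n N).+2 (z (t n) - point_ (u n)),
    forall n, mult (u n) = (weight test_code (s n) (t n) * (s n).+1)%N &
    forall n, level (u n) = maxn (s n.+1) N.+2].
  by split=> n; have [] := uP n; rewrite size_mkseq.
suff uT n : bounded_separated_at u n.
  by have [n] := test_tree_no_branch XM u; apply; apply/test_tree_mkseq.
elim/ltn_ind: n => n IH.
(* The codes entering the weight of index s j see only the first j entries. *)
have weightE j : (0 < j <= n)%N ->
    weight test_code (s j) (t n) = weight test_code (s j) (t j).
  move=> /andP[j0 jn].
  have tT k : (k <= n)%N -> test_tree (t k).
    by move=> kn; apply/test_tree_mkseq => i ik; apply: IH; exact: leq_trans kn.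
  apply: eq_bigr => i _; congr _.+1; rewrite /test_code !tree_codeT; [|exact: tT..].
  congr pickle.
  have -> : t n = t j ++ mkseq (fun i => u (j + i)%N) (n - j).
    rewrite /t /mkseq -{1}(subnKC jn) iotaD map_cat add0n; congr cat.
    by rewrite -[j in iota j _]addn0 iotaDl -map_comp.
  apply: cut_cat; apply/hasP; exists (u j.-1).
    by apply/mapP; exists j.-1 => //; rewrite mem_iota /= add0n prednK.
  by rewrite levelE prednK// leq_max (ltnW (ltn_ord i)).
split=> j /andP[j0 jn].
  apply: (dilate_perturb WP (x := z (t n))).
    by rewrite multE -weightE ?j0//; exact: sigmaP.
  apply: (bbaseC WP); apply: (bbase_le WP) (approx n).
  by rewrite ltnS leqW// leq_max jn.
have l0 : (N.+2 <= level (u 0%N))%N by rewrite levelE leq_maxr.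
move=> /(bbase_le WP l0) xW.
have tjn : t j != t n.
  by apply/eqP => /(congr1 size); rewrite !size_mkseq => jnE; rewrite jnE ltnn in jn.
apply: (NP _ _ tjn).
have aW k : W N.+2 (z (t k) - point_ (u k)).
  by apply: (bbase_le WP) (approx k); rewrite !ltnS leq_maxr.
have -> : f (kunit R test_code (t j)) - f (kunit R test_code (t n)) =
    ((z (t j) - point_ (u j)) + (point_ (u j) - point_ (u n))) +
    (point_ (u n) - z (t n)).
  by rewrite !addrA !subrK.
apply: (bbase_add WP); first exact: (bbase_add WP).
by apply: (bbase_le WP (leqnSn _)); exact: (bbaseC WP).
Qed.

End NoEmbedding.

Theorem corollary4p31 (R : realType) :
  ~ exists X : tvsType R,
      montel X /\
      forall Y : tvsType R, montel Y -> separable_space Y ->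
        exists2 F : set X, closed_linear_subspace F & tvs_isomorphic_onto Y F.
Proof.
move=> [X [XM univ]].
have [W WP] := exists_balanced_base (proj2 (proj1 XM)).
have [D DP] := montel_countable_net WP XM.
have YM := kspace_montel R (test_code_montel (D := D) WP XM).
have [F _] := univ _ YM (montel_separable YM).
exact: (@no_embedding _ _ _ WP D DP XM F).
Qed.
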